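(* Let $a,b\in\mathbb{R}$ with $b-a$ a positive integer, and let $\alpha:\mathbb{N}_{a,b}\to\mathbb{R}$ satisfy $0<\alpha(t)<1/2$ for all $t\in\mathbb{N}_{a,b}$. For all functions $f,g:\mathbb{N}_{a,b}\rightarrow\mathbb{R}$, the following four identities hold: $$\sum_{t=a+1}^{b-1}f(t)\;{}^{ABC}_{a}\nabla^{\alpha(t)}g(t)=g(t)\,\mathcal{E}_{\overline{\alpha(t),1},\frac{-\alpha(t)}{1-\alpha(t)},b^-}f(t)\Big|_{a}^{b-1}+\sum_{t=a+1}^{b-1}g(t-1)\;\bigl({}^{ABR}\widehat{\nabla}_b^{\alpha(\cdot)}f\bigr)(t-1);$$ $$\sum_{t=a+1}^{b-1}f(t)\;{}^{ABC}_{a}\widehat{\nabla}^{\alpha(t)}g(t)=g(t)\,\mathbf{E}_{\overline{\alpha(t),1},\frac{-\alpha(t)}{1-\alpha(t)},b^-}f(t)\Big|_{a}^{b-1}+\sum_{t=a+1}^{b-1}g(t-1)\;\bigl({}^{ABR}\nabla_b^{\alpha(\cdot)}f\bigr)(t-1);$$ $$\sum_{t=a+1}^{b-1}f(t)\;{}^{ABC}\nabla^{\alpha(t)}_{b}g(t)=-g(t)\,\mathcal{E}_{\overline{\alpha(t),1},\frac{-\alpha(t)}{1-\alpha(t)},a^+}f(t)\Big|_{a+1}^{b}+\sum_{t=a+1}^{b-1}g(t+1)\;\bigl({}^{ABR}_{a}\widehat{\nabla}^{\alpha(\cdot)}f\bigr)(t+1);$$ $$\sum_{t=a+1}^{b-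1}f(t)\;{}^{ABC}\widehat{\nabla}^{\alpha(t)}_{b}g(t)=-g(t)\,\mathbf{E}_{\overline{\alpha(t),1},\frac{-\alpha(t)}{1-\alpha(t)},a^+}f(t)\Big|_{a+1}^{b}+\sum_{t=a+1}^{b-1}g(t+1)\;\bigl({}^{ABR}_{a}\nabla^{\alpha(\cdot)}f\bigr)(t+1).$$
   Context: $\mathbb{N}_{a,b}=\{a,a+1,\dots,b\}$. Sums $\sum_{t=p}^{q}$ run over $t=p,p+1,\dots,q$ (empty sums are $0$). $\rho(t)=t-1$; $\nabla f(t)=f(t)-f(t-1)$; $\Delta f(t)=f(t+1)-f(t)$; $h(t)\big|_{p}^{q}=h(q)-h(p)$. $\Gamma$ is the Gamma function, and the rising function is $t^{\overline{\beta}}=\Gamma(t+\beta)/\Gamma(t)$ for real $\beta$ and $t\in\mathbb{R}\setminus\{\dots,-2,-1,0\}$, with $0^{\overline{\beta}}=0$. For $|\lambda|<1$ and $\beta>0$, the nabla discrete Mittag--Leffler function is $$E_{\overline{\beta}}(\lambda,z)=\sum_{k=0}^\infty\lambda^k\frac{z^{\overline{k\beta}}}{\Gamma(\beta k+1)},$$ also written $E_{\overline{\beta}}[\lambda,z]$. $B:[0,1]\to(0,\infty)$ is a normalization function with $B(0)=B(1)=1$. Discrete generalized fractional integral operators of variable order $\alpha(t)$ (bold $\mathbf{E}$ is type I, calligraphic $\mathcal{E}$ is type II). Left, for $t\in\{a+1,\dots,b\}$: $$\mathbf{E}_{\overline{\alpha(t),1},\frac{-\alpha(t)}{1-\alpha(t)},a^+}\varphi(t)=\frac{B(\alpha(t))}{1-\alpha(t)}\sum_{s=a+1}^tE_{\overline{\alpha(t)}}\left[\frac{-\alpha(t)}{1-\alpha(t)},t-\rho(s)\right]\varphi(s),$$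 $$\mathcal{E}_{\overline{\alpha(t),1},\frac{-\alpha(t)}{1-\alpha(t)},a^+}\varphi(t)=\sum_{s=a+1}^t\frac{B(\alpha(s))}{1-\alpha(s)}E_{\overline{\alpha(s)}}\left[\frac{-\alpha(s)}{1-\alpha(s)},t-\rho(s)\right]\varphi(s).$$ Right, for $t\in\{a,\dots,b-1\}$: $$\mathbf{E}_{\overline{\alpha(t),1},\frac{-\alpha(t)}{1-\alpha(t)},b^-}\varphi(t)=\frac{B(\alpha(t))}{1-\alpha(t)}\sum_{s=t}^{b-1}E_{\overline{\alpha(t)}}\left[\frac{-\alpha(t)}{1-\alpha(t)},s-\rho(t)\right]\varphi(s),$$ $$\mathcal{E}_{\overline{\alpha(t),1},\frac{-\alpha(t)}{1-\alpha(t)},b^-}\varphi(t)=\sum_{s=t}^{b-1}\frac{B(\alpha(s))}{1-\alpha(s)}E_{\overline{\alpha(s)}}\left[\frac{-\alpha(s)}{1-\alpha(s)},s-\rho(t)\right]\varphi(s).$$ Riemann--Liouville $AB$ nabla fractional differences (no hat: type I; hat: type II), where the outer $\nabla$ or $\Delta$ acts on the whole function $t\mapsto\mathbf{E}_{\dots}f(t)$ or $t\mapsto\mathcal{E}_{\dots}f(t)$: $${}^{ABR}_{a}\nabla^{\alpha(t)}f(t)=\nabla\,\mathbf{E}_{\overline{\alpha(t),1},\frac{-\alpha(t)}{1-\alpha(t)},a^+}f(t),\qquad {}^{ABR}_{a}\widehat{\nabla}^{\alpha(t)}f(t)=\nabla\,\mathcal{E}_{\overline{\alpha(t),1},\frac{-\alpha(t)}{1-\alpha(t)},a^+}f(t),$$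 $${}^{ABR}\nabla_b^{\alpha(t)}f(t)=-\Delta\,\mathbf{E}_{\overline{\alpha(t),1},\frac{-\alpha(t)}{1-\alpha(t)},b^-}f(t),\qquad {}^{ABR}\widehat{\nabla}_b^{\alpha(t)}f(t)=-\Delta\,\mathcal{E}_{\overline{\alpha(t),1},\frac{-\alpha(t)}{1-\alpha(t)},b^-}f(t).$$ The notation $(\,\cdot\,f)(t-1)$, respectively $(\,\cdot\,f)(t+1)$, means the value at the point $t-1$, respectively $t+1$, of the function obtained by applying the operator to $f$. Caputo $AB$ nabla fractional differences (no hat: type I; hat: type II): $${}^{ABC}_{a}\nabla^{\alpha(t)}f(t)=\mathbf{E}_{\overline{\alpha(t),1},\frac{-\alpha(t)}{1-\alpha(t)},a^+}(\nabla f)(t),\qquad {}^{ABC}_{a}\widehat{\nabla}^{\alpha(t)}f(t)=\mathcal{E}_{\overline{\alpha(t),1},\frac{-\alpha(t)}{1-\alpha(t)},a^+}(\nabla f)(t),$$ $${}^{ABC}\nabla^{\alpha(t)}_{b}f(t)=-\mathbf{E}_{\overline{\alpha(t),1},\frac{-\alpha(t)}{1-\alpha(t)},b^-}(\Delta f)(t),\qquad {}^{ABC}\widehat{\nabla}^{\alpha(t)}_{b}f(t)=-\mathcal{E}_{\overline{\alpha(t),1},\frac{-\alpha(t)}{1-\alpha(t)},b^-}(\Delta f)(t).$$ *)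

(* Defs.v *)
From HB Require Import structures.
From mathcomp Require Import all_boot all_order all_algebra.
From mathcomp Require Import all_classical all_reals all_analysis.
Set Implicit Arguments.
Unset Strict Implicit.
Unset Printing Implicit Defensive.
Import Order.TTheory GRing.Theory Num.Theory.
Import numFieldNormedType.Exports.
Local Open Scope classical_set_scope.
Local Open Scope ring_scope.

(** Functions on the time scale {a, a+1, ..., b} are represented by total
    functions [R -> R]; for [t] in the ranges where the operators below are
    meant to be used, they only evaluate their arguments inside the scale. *)

Definition discrete_itv (R : realType) (a b : R) : set R :=
  [set t | a <= t <= b /\ t - a \is a Num.nat].

(** The sum over t = p, p+1, ..., q, for p and q real with q - p an integer;
    [Num.truncn] sends negative reals to 0, so the sum is 0 when q < p. *)
Definition sum_itv (R : realType) (p q : R) (F : R -> R) : R :=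
  \sum_(k < Num.truncn (q - p + 1)) F (p + k%:R).

Definition diff_itv (R : realType) (p q : R) (h : R -> R) : R := h q - h p.

Definition rho (R : realType) (t : R) : R := t - 1.

Definition nabla (R : realType) (f : R -> R) : R -> R :=
  fun t => f t - f (t - 1).

Definition Delta (R : realType) (f : R -> R) : R -> R :=
  fun t => f (t + 1) - f t.

(** Euler's integral, which is the Gamma function for x > 0. *)
Definition Gamma_pos (R : realType) (x : R) : R :=
  (\int[lebesgue_measure]_(u in `]0%R, +oo[) (u `^ (x - 1) * expR (- u)))%R.

(** For x <= 0, Gamma is continued by Gamma (x + 1) = x * Gamma x, iterated
    until x + n is positive; the value at the poles 0, -1, -2, ... is junk. *)
Definition Gamma (R : realType) (x : R) : R :=
  let n := if 0 < x then 0%N else (Num.truncn (- x)).+1 in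
  Gamma_pos (x + n%:R) / \prod_(i < n) (x + i%:R).

Definition rising (R : realType) (t beta : R) : R :=
  if t == 0 then 0 else Gamma (t + beta) / Gamma t.

Definition mittag_leffler (R : realType) (beta lambda z : R) : R :=
  limn (series (fun k : nat =>
    lambda ^+ k * (rising z (k%:R * beta) / Gamma (beta * k%:R + 1)))).

(** Generalized fractional integrals of variable order [alpha]: type I takes
    the order at the evaluation point, type II at the summation variable. *)

Definition intI_left (R : realType) (B alpha : R -> R) (a : R) (phi : R -> R) :
    R -> R := fun t =>
  B (alpha t) / (1 - alpha t) *
  sum_itv (a + 1) t (fun s =>
    mittag_leffler (alpha t) (- alpha t / (1 - alpha t)) (t - rho s) * phi s).

Definition intII_left (R : realType) (B alpha : R -> R) (a : R)
    (phi : R -> R) : R -> R := fun t =>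
  sum_itv (a + 1) t (fun s =>
    B (alpha s) / (1 - alpha s) *
    mittag_leffler (alpha s) (- alpha s / (1 - alpha s)) (t - rho s) * phi s).

Definition intI_right (R : realType) (B alpha : R -> R) (b : R)
    (phi : R -> R) : R -> R := fun t =>
  B (alpha t) / (1 - alpha t) *
  sum_itv t (b - 1) (fun s =>
    mittag_leffler (alpha t) (- alpha t / (1 - alpha t)) (s - rho t) * phi s).

Definition intII_right (R : realType) (B alpha : R -> R) (b : R)
    (phi : R -> R) : R -> R := fun t =>
  sum_itv t (b - 1) (fun s =>
    B (alpha s) / (1 - alpha s) *
    mittag_leffler (alpha s) (- alpha s / (1 - alpha s)) (s - rho t) * phi s).

(** Riemann-Liouville (ABR) and Caputo (ABC) AB nabla differences; the type II
    operators are the ones written with a hat. *)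

Definition ABRI_left (R : realType) (B alpha : R -> R) (a : R) (f : R -> R) :
  R -> R := nabla (intI_left B alpha a f).

Definition ABRII_left (R : realType) (B alpha : R -> R) (a : R) (f : R -> R) :
  R -> R := nabla (intII_left B alpha a f).

Definition ABRI_right (R : realType) (B alpha : R -> R) (b : R) (f : R -> R) :
  R -> R := fun t => - Delta (intI_right B alpha b f) t.

Definition ABRII_right (R : realType) (B alpha : R -> R) (b : R)
  (f : R -> R) : R -> R := fun t => - Delta (intII_right B alpha b f) t.

Definition ABCI_left (R : realType) (B alpha : R -> R) (a : R) (f : R -> R) :
  R -> R := intI_left B alpha a (nabla f).

Definition ABCII_left (R : realType) (B alpha : R -> R) (a : R) (f : R -> R) :
  R -> R := intII_left B alpha a (nabla f).

Definition ABCI_right (R : realType) (B alpha : R -> R) (b : R) (f : R -> R) :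
  R -> R := fun t => - intI_right B alpha b (Delta f) t.

Definition ABCII_right (R : realType) (B alpha : R -> R) (b : R)
  (f : R -> R) : R -> R := fun t => - intII_right B alpha b (Delta f) t.

(* Main.v *)
(** Exchanging the two summations turns the sum of [f] times a Caputo
    difference of [g] into the sum of a first difference of [g] times the
    opposite-sided integral of [f], of the opposite type because the order now
    sits at the inner summation variable.  Summation by parts then concludes.
    Both steps work for an arbitrary kernel in place of the Mittag-Leffler one. *)
Require Import Defs.
From HB Require Import structures.
From mathcomp Require Import all_boot all_order all_algebra.
From mathcomp Require Import all_classical all_reals all_analysis.
From mathcomp Require Import ring.
Import Order.TTheory GRing.Theory Num.Theory.
Import numFieldNormedType.Exports.
Local Open Scope classical_set_scope.
Local Open Scope ring_scope.

Lemma sum_itvE {R : realType} {p q : R} {n : nat} (F : R -> R) :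
  q - p + 1 = n%:R -> sum_itv p q F = \sum_(k < n) F (p + k%:R).
Proof. by move=> pqn; rewrite /sum_itv pqn natrK. Qed.

Lemma eq_sum_itv {R : realType} {p q : R} {F G : R -> R} :
  F =1 G -> sum_itv p q F = sum_itv p q G.
Proof. by move=> FG; apply: eq_bigr => k _; exact: FG. Qed.

Lemma sum_itvD {R : realType} {p q : R} (F G : R -> R) :
  sum_itv p q (fun t => F t + G t) = sum_itv p q F + sum_itv p q G.
Proof. exact: big_split. Qed.

Lemma sum_itvN {R : realType} {p q : R} (F : R -> R) :
  sum_itv p q (fun t => - F t) = - sum_itv p q F.
Proof. exact: sumrN. Qed.

Lemma mulr_sum_itvr {R : realType} {p q : R} (c : R) (F : R -> R) :
  c * sum_itv p q F = sum_itv p q (fun t => c * F t).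
Proof. exact: mulr_sumr. Qed.

(** Both sides run over the triangle [j <= i < n], by rows and then by columns with [i = j + k]. By
    induction, the new row [i = n] appends one term to each column [j < n] and opens the one-term
    column [j = n]. *)
Lemma exchange_triangle {V : nmodType} (n : nat) (G : nat -> nat -> V) :
  \sum_(i < n) \sum_(j < i.+1) G i j =
  \sum_(j < n) \sum_(k < n - j) G (j + k)%N j.
Proof.
elim: n => [|n IHn]; first by rewrite !big_ord0.
rewrite big_ord_recr /= IHn [RHS]big_ord_recr /= subSnn big_ord1 addn0.
rewrite big_ord_recr /= addrA -big_split /=; congr (_ + _).
apply: eq_bigr => j _.
by rewrite subSn 1?ltnW// big_ord_recr /= subnKC 1?ltnW.
Qed.

Lemma exchange_sum_itv {R : realType} {p q : R} (F : R -> R -> R) :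
  q - p + 1 \is a Num.nat ->
  sum_itv p q (fun t => sum_itv p t (F t)) =
  sum_itv p q (fun s => sum_itv s q (F^~ s)).
Proof.
move=> /natrP[n pqn]; rewrite !(sum_itvE _ pqn).
transitivity (\sum_(i < n) \sum_(j < i.+1) F (p + i%:R) (p + j%:R)).
  apply: eq_bigr => i _; apply: sum_itvE.
  by rewrite -natr1; ring.
rewrite (exchange_triangle n (fun i j => F (p + i%:R) (p + j%:R))).
(* The points from [p + j] to [q] number [n - j], which matches the length of column [j]. *)
apply: eq_bigr => j _; rewrite (@sum_itvE _ _ _ (n - j)%N); last first.
  by rewrite natrB 1?ltnW// -pqn; ring.
by apply: eq_bigr => k _; rewrite natrD addrA.
Qed.

Lemma sum_itv_Delta {R : realType} {p q : R} (h : R -> R) :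
  q - p + 1 \is a Num.nat -> sum_itv p q (Delta h) = diff_itv p (q + 1) h.
Proof.
move=> /natrP[n pqn]; rewrite (sum_itvE _ pqn) /diff_itv.
have -> : q + 1 = p + n%:R by rewrite -pqn; ring.
elim: n {pqn} => [|n IHn]; first by rewrite big_ord0 addr0 subrr.
by rewrite big_ord_recr /= IHn /Delta -natr1 (addrA p); ring.
Qed.

Lemma sum_itv_nabla {R : realType} {p q : R} (h : R -> R) :
  q - p + 1 \is a Num.nat -> sum_itv p q (nabla h) = diff_itv (p - 1) q h.
Proof.
move=> pq; transitivity (sum_itv p q (Delta (fun t => h (t - 1)))).
  by apply: eq_sum_itv => t; rewrite /nabla /Delta addrK.
by rewrite sum_itv_Delta// /diff_itv addrK.
Qed.

(** The kernel [K] is left free so that both types are instances. In [H] its first argument has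
    become the summation variable, which is why the type switches. *)
Lemma sum_itv_caputo_left {R : realType} {p q : R} (K : R -> R -> R)
    (f g : R -> R) :
  let H := fun s => sum_itv s q (fun t => K t s * f t) in
  q - p + 1 \is a Num.nat ->
  sum_itv p q (fun t => f t * sum_itv p t (fun s => K t s * nabla g s)) =
  diff_itv (p - 1) q (fun t => g t * H t) +
  sum_itv p q (fun t => g (t - 1) * - Delta H (t - 1)).
Proof.
move=> H pq; rewrite -sum_itv_nabla// -sum_itvD.
under eq_sum_itv => t do rewrite mulr_sum_itvr.
rewrite (exchange_sum_itv (fun t s => f t * (K t s * nabla g s)))//.
apply: eq_sum_itv => s; transitivity (nabla g s * H s).
  by rewrite mulr_sum_itvr; apply: eq_sum_itv => t /=; ring.
(* Discrete Leibniz rule: [nabla g s * H s] is the backward difference of [g * H] at [s] minus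
   [g (s - 1) * Delta H (s - 1)]. *)
by rewrite /nabla /Delta subrK; ring.
Qed.

Lemma sum_itv_caputo_right {R : realType} {p q : R} (K : R -> R -> R)
    (f g : R -> R) :
  let H := fun s => sum_itv p s (fun t => K t s * f t) in
  q - p + 1 \is a Num.nat ->
  sum_itv p q (fun t => f t * - sum_itv t q (fun s => K t s * Delta g s)) =
  - diff_itv p (q + 1) (fun t => g t * H t) +
  sum_itv p q (fun t => g (t + 1) * nabla H (t + 1)).
Proof.
move=> H pq; rewrite -sum_itv_Delta// -sum_itvN -sum_itvD.
under eq_sum_itv => t do rewrite mulrN mulr_sum_itvr.
(* Here the inner sum starts at the outer variable, so the exchange is applied from right to
   left. *)
rewrite sum_itvN -(exchange_sum_itv (fun s t => f t * (K t s * Delta g s)))//.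
rewrite -sum_itvN; apply: eq_sum_itv => s; transitivity (- (Delta g s * H s)).
  rewrite mulr_sum_itvr; congr (- _).
  by apply: eq_sum_itv => t /=; ring.
by rewrite /nabla /Delta addrK; ring.
Qed.

Theorem theorem2 (R : realType) (B : R -> R)
    (B_gt0 : forall x, 0 <= x <= 1 -> 0 < B x) (B0 : B 0 = 1) (B1 : B 1 = 1)
    (a b : R) (ab_gt0 : 0 < b - a) (ab_int : b - a \is a Num.int)
    (alpha : R -> R)
    (alpha_bound : forall t, discrete_itv a b t -> 0 < alpha t < 1 / 2)
    (f g : R -> R) :
  [/\ sum_itv (a + 1) (b - 1) (fun t => f t * ABCI_left B alpha a g t) =
        diff_itv a (b - 1) (fun t => g t * intII_right B alpha b f t) +
        sum_itv (a + 1) (b - 1)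
          (fun t => g (t - 1) * ABRII_right B alpha b f (t - 1)),
      sum_itv (a + 1) (b - 1) (fun t => f t * ABCII_left B alpha a g t) =
        diff_itv a (b - 1) (fun t => g t * intI_right B alpha b f t) +
        sum_itv (a + 1) (b - 1)
          (fun t => g (t - 1) * ABRI_right B alpha b f (t - 1)),
      sum_itv (a + 1) (b - 1) (fun t => f t * ABCI_right B alpha b g t) =
        - diff_itv (a + 1) b (fun t => g t * intII_left B alpha a f t) +
        sum_itv (a + 1) (b - 1)
          (fun t => g (t + 1) * ABRII_left B alpha a f (t + 1)) &
      sum_itv (a + 1) (b - 1) (fun t => f t * ABCII_right B alpha b g t) =
        - diff_itv (a + 1) b (fun t => g t * intI_left B alpha a f t) +
        sum_itv (a + 1) (b - 1)
          (fun t => g (t + 1) * ABRI_left B alpha a f (t + 1))].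
Proof.
pose w t := B (alpha t) / (1 - alpha t).
pose E t z := mittag_leffler (alpha t) (- alpha t / (1 - alpha t)) z.
(* The number of summation points is [b - a - 1], a natural number because the integer [b - a] is at
   least 1; it is zero when [b = a + 1]. *)
have pq : b - 1 - (a + 1) + 1 \is a Num.nat.
  have /natrP[[|n] abn] : b - a \is a Num.nat by rewrite natrEint ab_int ltW.
    by move: ab_gt0; rewrite abn ltxx.
  have -> : b - 1 - (a + 1) + 1 = b - a - 1 by ring.
  by rewrite abn -natr1 addrK natr_nat.
(* Moving the type I prefactor under the sum gives it the kernel shape that type II has by
   definition. *)
have intI_leftE h : intI_left B alpha a h =
    fun t => sum_itv (a + 1) t (fun s => w t * E t (t - rho s) * h s).
  apply/funext => t; rewrite /intI_left mulr_sum_itvr.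
  by apply: eq_sum_itv => s; rewrite mulrA.
have intI_rightE h : intI_right B alpha b h =
    fun t => sum_itv t (b - 1) (fun s => w t * E t (s - rho t) * h s).
  apply/funext => t; rewrite /intI_right mulr_sum_itvr.
  by apply: eq_sum_itv => s; rewrite mulrA.
have caputo_left K := sum_itv_caputo_left K f g pq.
have caputo_right K := sum_itv_caputo_right K f g pq.
rewrite addrK in caputo_left; rewrite subrK in caputo_right.
rewrite /ABCI_left /ABCI_right /ABRI_left /ABRI_right.
rewrite !intI_leftE !intI_rightE; split.
(* In each kernel [t] is the Caputo evaluation point and [s] the point where the difference of [g]
   is taken; an order read at [t] gives the type I Caputo difference, and one read at [s] gives type
   II. *)
- exact: (caputo_left (fun t s => w t * E t (t - rho s))).
- exact: (caputo_left (fun t s => w s * E s (t - rho s))).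
- exact: (caputo_right (fun t s => w t * E t (s - rho t))).
- exact: (caputo_right (fun t s => w s * E s (s - rho t))).
Qed.
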